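(* (1) Let $G$ and $G'$ be graphs. (i) If $\mathrm{C}(G';H)>\mathrm{C}(G;H)$ for some graph $H$, then there is no homomorphism from $G'$ to $G$. (ii) If $\mathrm{IC}(G';H)>\mathrm{IC}(G;H)$ for some graph $H$, then there is no injective homomorphism from $G'$ to $G$. (2) Let $H$ and $H'$ be graphs. (i) If $\mathrm{C}(G;H)>\mathrm{C}(G;H')$ for some graph $G$, then there is no homomorphism from $H'$ to $H$. (ii) If $\mathrm{IC}(G;H)>\mathrm{IC}(G;H')$ for some graph $G$, then there is no injective homomorphism from $H'$ to $H$.
   Context: ''Graph'' means either an undirected graph (loops allowed) or a directed graph (a set of vertices with a binary relation), without multiple edges; all graphs in the statement are of the same kind. A homomorphism $f:G\to H$ is a map $f:V(G)\to V(H)$ with $f(u)f(v)\in E(H)$ whenever $uv\in E(G)$; it is injective if it is injective on vertices and the induced map on edges is injective (the former implies the latter). A subgraph of $G$ is a graph whose vertex and edge sets are subsets of $V(G)$, $E(G)$. The union $G_1\cup\cdots\cup G_k$ has vertex set $\bigcup_i V(G_i)$ and edge set $\bigcup_i E(G_i)$. The hom-complexity $\mathrm{C}(G;H)$ is the least positive integer $k$ such that there are subgraphs $G_1,\dots,G_k$ of $G$ with $G=G_1\cup\cdots\cup G_k$ and, for each $i$, a homomorphism $G_i\to H$; $\mathrm{C}(G;H)=\infty$ if no such $k$ exists. The injective hom-complexity $\mathrm{IC}(G;H)$ is defined in the same way, requiring for each $i$ an injective homomorphism $G_i\to H$. *)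

(* Defs.v *)
From HB Require Import structures.
From mathcomp Require Import all_boot all_order all_algebra.
From mathcomp Require Import boolp classical_sets constructive_ereal.

Set Implicit Arguments.
Unset Strict Implicit.
Unset Printing Implicit Defensive.

Local Open Scope classical_set_scope.

Inductive kind := undirected | directed.

(* Vertex sets are arbitrary: possibly empty, possibly infinite. The edge set is
   a set of ordered pairs; when k = undirected it is symmetric, and the
   undirected edge uv is represented by the two pairs (u, v) and (v, u). *)
Record graph (k : kind) := Graph {
  vertex : Type;
  edge : set (vertex * vertex);
  edge_sym : k = undirected -> forall u v, edge (u, v) -> edge (v, u) }.

(* Whether two ordered pairs represent the same edge. *)
Definition same_edge (k : kind) (V : Type) (e e' : V * V) : Prop :=
  e = e' \/ k = undirected /\ e = (e'.2, e'.1).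

Section Homomorphisms.
Variable k : kind.

Definition is_hom (G H : graph k) (f : vertex G -> vertex H) : Prop :=
  forall u v, edge (u, v) -> edge (f u, f v).

Definition edge_map (G H : graph k) (f : vertex G -> vertex H)
    (e : vertex G * vertex G) : vertex H * vertex H := (f e.1, f e.2).

Definition is_injective_hom (G H : graph k) (f : vertex G -> vertex H) : Prop :=
  [/\ is_hom f,
      forall u v, f u = f v -> u = v
    & forall e e', edge e -> edge e' ->
        same_edge k (edge_map f e) (edge_map f e') -> same_edge k e e'].

Definition has_hom (G H : graph k) : Prop :=
  exists f : vertex G -> vertex H, is_hom f.

Definition has_injective_hom (G H : graph k) : Prop :=
  exists f : vertex G -> vertex H, is_injective_hom f.

End Homomorphisms.

Record subgraph (k : kind) (G : graph k) := Subgraph {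
  sub_vertex : set (vertex G);
  sub_edge : set (vertex G * vertex G);
  sub_edgeS : sub_edge `<=` edge (g := G);
  sub_edge_ends : forall u v, sub_edge (u, v) -> sub_vertex u /\ sub_vertex v;
  sub_edge_sym :
    k = undirected -> forall u v, sub_edge (u, v) -> sub_edge (v, u) }.

Section Complexity.
Variable k : kind.

Definition graph_of_sub (G : graph k) (S : subgraph G) : graph k :=
  {| vertex := set_type (sub_vertex S);
     edge := [set e | sub_edge S (val e.1, val e.2)];
     edge_sym := fun ku u v => sub_edge_sym ku (u := val u) (v := val v) |}.

Definition is_union (G : graph k) (n : nat) (S : 'I_n -> subgraph G) : Prop :=
  \bigcup_i sub_vertex (S i) = [set: vertex G] /\
  \bigcup_i sub_edge (S i) = edge (g := G).

Definition hom_cover (G H : graph k) (n : nat) : Prop :=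
  (0 < n)%N /\ exists S : 'I_n -> subgraph G,
    is_union S /\ forall i, has_hom (graph_of_sub (S i)) H.

Definition injective_hom_cover (G H : graph k) (n : nat) : Prop :=
  (0 < n)%N /\ exists S : 'I_n -> subgraph G,
    is_union S /\ forall i, has_injective_hom (graph_of_sub (S i)) H.

End Complexity.

(* The least n satisfying P, or +oo when there is none. *)
Definition least_or_infty (P : nat -> Prop) : \bar int :=
  match pselect (exists n, `[< P n >]) with
  | left exP => (Posz (ex_minn exP))%:E
  | right _ => +oo%E
  end.

Definition hom_complexity (k : kind) (G H : graph k) : \bar int :=
  least_or_infty (hom_cover G H).

Definition injective_hom_complexity (k : kind) (G H : graph k) : \bar int :=
  least_or_infty (injective_hom_cover G H).

(* Main.v *)
Require Import Defs.
From mathcomp Require Import all_boot all_order all_algebra.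
From mathcomp Require Import boolp classical_sets constructive_ereal.

(** A homomorphism f : G' -> G pulls a cover of G by subgraphs back to a cover
of G' with the same number of members, and f restricts to a homomorphism from
each pulled-back member to the original one; composing with homomorphisms to H
gives C(G'; H) <= C(G; H). Composing the homomorphisms of a cover with
H' -> H gives C(G; H) <= C(G; H'). Both constructions preserve injectivity. *)

Set Implicit Arguments.
Unset Strict Implicit.
Unset Printing Implicit Defensive.

Local Open Scope classical_set_scope.

(** A larger set of integers has a smaller minimum, and the value [+oo] of the empty set is the
    greatest one. Each comparison of complexities thus reduces to turning a cover into another cover
    of the same size. *)
Lemma le_least_or_infty (P Q : nat -> Prop) :
  (forall n, P n -> Q n) -> (least_or_infty Q <= least_or_infty P)%E.
Proof.
move=> PQ; rewrite /least_or_infty.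
case: (pselect (exists n, `[< P n >])) => [exP|_]; last by rewrite leey.
case: (pselect (exists n, `[< Q n >])) => [exQ|noQ]; last first.
  by case: noQ; have [n /asboolP/PQ Qn] := exP; exists n; apply/asboolP.
(* Here [n] is the least element of [Q] and [m] that of [P]; since [m] also satisfies [Q],
   minimality of [n] applies to it. *)
case: ex_minnP => n _ minQ; case: ex_minnP => m /asboolP/PQ Qm _.
by rewrite lee_fin lez_nat; apply/minQ/asboolP.
Qed.

Section Morphisms.
Variable k : kind.
Implicit Types G H K : graph k.

(** Applying [f] to both ends of a pair commutes with swapping the ends, so injectivity on vertices
    yields injectivity on edges, in the undirected case too. *)
Lemma injective_homP G H (f : vertex G -> vertex H) :
  is_injective_hom f <-> is_hom f /\ injective f.
Proof.
split=> [[homf injf _]|[homf injf]]; first by split=> // u v /injf.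
split=> //.
move=> [a b] [c d] _ _; case=> [[/injf-> /injf->]|[ku [/injf-> /injf->]]].
  by left.
by right.
Qed.

Lemma comp_is_hom G H K (f : vertex G -> vertex H) (g : vertex H -> vertex K) :
  is_hom f -> is_hom g -> is_hom (g \o f).
Proof. by move=> homf homg u v /homf/homg. Qed.

Lemma has_hom_trans G H K : has_hom G H -> has_hom H K -> has_hom G K.
Proof.
by move=> [f homf] [g homg]; exists (g \o f); apply: comp_is_hom.
Qed.

Lemma has_injective_hom_trans G H K :
  has_injective_hom G H -> has_injective_hom H K -> has_injective_hom G K.
Proof.
move=> [f /injective_homP[homf injf]] [g /injective_homP[homg injg]].
exists (g \o f); apply/injective_homP.
by split; [apply: comp_is_hom | apply: inj_comp].
Qed.

End Morphisms.

Section Pullback.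
Variables (k : kind) (G' G : graph k) (f : vertex G' -> vertex G).

#[local] Obligation Tactic := idtac.

(** The condition [edge e] keeps the result inside [G']: a non-edge of [G'] may well be sent to an
    edge of [S]. *)
Program Definition preim_subgraph (S : subgraph G) : subgraph G' :=
  {| sub_vertex := f @^-1` sub_vertex S;
     sub_edge := [set e | edge e /\ sub_edge S (f e.1, f e.2)] |}.
Next Obligation. by move=> S e []. Qed.
Next Obligation. by move=> S u v [_ /sub_edge_ends]. Qed.
Next Obligation.
by move=> S ku u v [uv fuv]; split; [apply: edge_sym | apply: sub_edge_sym].
Qed.

Lemma preim_is_union n (S : 'I_n -> subgraph G) :
  is_hom f -> is_union S -> is_union (fun i => preim_subgraph (S i)).
Proof.
move=> homf [vS eS]; split; apply/seteqP; split=> //.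
- move=> u _; have : (\bigcup_i sub_vertex (S i)) (f u) by rewrite vS.
  by case=> i _ Siu; exists i.
- by move=> e [i _ []].
(* As [f] is a homomorphism, the image of an edge is an edge of [G], hence lies in some [S i]; the
   edge itself then lies in the preimage of that [S i]. *)
- move=> [u v] uv; have : (\bigcup_i sub_edge (S i)) (f u, f v).
    by rewrite eS; apply: homf.
  by case=> i _ Siuv; exists i.
Qed.

(** This is [f] restricted to the preimage of [S]. Membership of [val x] in the preimage is, by
    conversion, membership of [f (val x)] in [sub_vertex S]. *)
Definition preim_map (S : subgraph G)
    (x : vertex (graph_of_sub (preim_subgraph S))) : vertex (graph_of_sub S) :=
  SigSub (mem_set (set_mem (valP x) : sub_vertex S (f (val x)))).

Lemma preim_map_is_hom (S : subgraph G) : is_hom (@preim_map S).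
Proof. by move=> u v []. Qed.

Lemma preim_map_inj (S : subgraph G) : injective f -> injective (@preim_map S).
Proof. by move=> injf u v /(congr1 val)/= /injf /val_inj. Qed.

End Pullback.

Section Monotonicity.
Variable k : kind.
Implicit Types G H : graph k.

Lemma le_hom_complexity_l G' G H :
  has_hom G' G -> (hom_complexity G' H <= hom_complexity G H)%E.
Proof.
move=> [f homf]; apply: le_least_or_infty => n [n0 [S [US SH]]].
split=> //; exists (fun i => preim_subgraph f (S i)).
split=> [|i]; first exact: preim_is_union.
(* The homomorphism to [H] is the composite through [S i]. *)
by apply: has_hom_trans (SH i); exists (@preim_map _ _ _ f (S i));
  apply: preim_map_is_hom.
Qed.

Lemma le_injective_hom_complexity_l G' G H : has_injective_hom G' G ->
  (injective_hom_complexity G' H <= injective_hom_complexity G H)%E.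
Proof.
move=> [f /injective_homP[homf injf]].
apply: le_least_or_infty => n [n0 [S [US SH]]].
split=> //; exists (fun i => preim_subgraph f (S i)).
split=> [|i]; first exact: preim_is_union.
apply: has_injective_hom_trans (SH i); exists (@preim_map _ _ _ f (S i)).
by apply/injective_homP; split; [apply: preim_map_is_hom|apply: preim_map_inj].
Qed.

Lemma le_hom_complexity_r G H' H :
  has_hom H' H -> (hom_complexity G H <= hom_complexity G H')%E.
Proof.
move=> homH; apply: le_least_or_infty => n [n0 [S [US SH]]].
by split=> //; exists S; split=> // i; apply: has_hom_trans (SH i) homH.
Qed.

Lemma le_injective_hom_complexity_r G H' H : has_injective_hom H' H ->
  (injective_hom_complexity G H <= injective_hom_complexity G H')%E.
Proof.
move=> homH; apply: le_least_or_infty => n [n0 [S [US SH]]].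
split=> //; exists S; split=> // i.
exact: has_injective_hom_trans (SH i) homH.
Qed.

End Monotonicity.

Theorem proposition3p10 (k : kind) :
  (forall G G' : graph k,
    ((exists H : graph k, (hom_complexity G' H > hom_complexity G H)%E) ->
       ~ has_hom G' G) /\
    ((exists H : graph k,
        (injective_hom_complexity G' H > injective_hom_complexity G H)%E) ->
       ~ has_injective_hom G' G)) /\
  (forall H H' : graph k,
    ((exists G : graph k, (hom_complexity G H > hom_complexity G H')%E) ->
       ~ has_hom H' H) /\
    ((exists G : graph k,
        (injective_hom_complexity G H > injective_hom_complexity G H')%E) ->
       ~ has_injective_hom H' H)).
Proof.
(* In all four cases the negated strict inequality becomes the reverse weak one, which is
   monotonicity along [hom]. *)
split=> [G G'|H H']; split=> -[X ltX] hom; move: ltX; apply/negP;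
  rewrite -Order.TotalTheory.leNgt.
- exact: le_hom_complexity_l.
- exact: le_injective_hom_complexity_l.
- exact: le_hom_complexity_r.
- exact: le_injective_hom_complexity_r.
Qed.
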